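(* For every $k\in\mathbb{N}$ and every $n\in\mathbb{N}$, \[ \mathrm{exm}(n,J_k) \le \frac{8}{3}(k+1)^2\cdot 2^{4k}\, n. \]
   Context: $J_k$ is the $k\times k$ matrix all of whose entries are $1$. An interval decomposition of the rows of a matrix is a partition of its rows into nonempty intervals of consecutive rows (similarly for columns). A block decomposition is given by an interval decomposition of rows into $t$ intervals and of columns into $t'$ intervals; the $(i,j)$-block is the submatrix on the $i$th row interval and the $j$th column interval. Contracting the blocks produces the $t\times t'$ binary matrix whose $(i,j)$ entry is $0$ iff the $(i,j)$-block is all zeros. A binary matrix $B$ is an interval minor of a binary matrix $A$ if $B$ can be obtained from $A$ by contracting the blocks of some block decomposition and then possibly replacing some $1$-entries by $0$-entries. $\mathrm{exm}(n,B)$ is the maximum number of $1$-entries in an $n\times n$ binary matrix that does not have $B$ as an interval minor. *)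

(* Defs.v *)
From HB Require Import structures.
From mathcomp Require Import all_boot all_order all_algebra.

Set Implicit Arguments.
Unset Strict Implicit.
Unset Printing Implicit Defensive.

(* Binary matrices are matrices over [bool], with [true] for 1 and [false]
   for 0.  Rows and columns are numbered from 0. *)

Definition all_ones_mx (k : nat) : 'M[bool]_k := const_mx true.

Definition num_ones (m n : nat) (A : 'M[bool]_(m, n)) : nat :=
  #|[set p : 'I_m * 'I_n | A p.1 p.2]|.

Definition is_interval (m : nat) (S : {set 'I_m}) : bool :=
  [forall x in S, forall z in S, forall y : 'I_m, (x <= y <= z) ==> (y \in S)].

(* [I i] is the i-th interval, counted in increasing order of position.
   [partition] includes nonemptiness of the parts; together with the order
   condition this forces the [I i] to be [t] distinct sets. *)
Definition interval_decomposition (m t : nat)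
    (I : {ffun 'I_t -> {set 'I_m}}) : bool :=
  [&& partition [set I i | i : 'I_t] [set: 'I_m],
      [forall i : 'I_t, is_interval (I i)]
    & [forall i : 'I_t, forall j : 'I_t, (i < j) ==>
        [forall x in I i, forall y in I j, x < y]]].

Definition contract_blocks (m n t t' : nat) (A : 'M[bool]_(m, n))
    (R : {ffun 'I_t -> {set 'I_m}}) (C : {ffun 'I_t' -> {set 'I_n}}) :
    'M[bool]_(t, t') :=
  \matrix_(i < t, j < t') ~~ [forall x in R i, forall y in C j, ~~ A x y].

Definition interval_minor (t t' m n : nat)
    (B : 'M[bool]_(t, t')) (A : 'M[bool]_(m, n)) : bool :=
  [exists R : {ffun 'I_t -> {set 'I_m}},
   exists C : {ffun 'I_t' -> {set 'I_n}},
    [&& interval_decomposition R, interval_decomposition C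
      & [forall i : 'I_t, forall j : 'I_t',
          B i j ==> contract_blocks A R C i j]]].

(* The value is 0 when no n x n matrix avoids [B]. *)
Definition exm (n t t' : nat) (B : 'M[bool]_(t, t')) : nat :=
  \max_(A : 'M[bool]_n | ~~ interval_minor B A) num_ones A.

(* Main.v *)
Require Import Defs.
From HB Require Import structures.
From mathcomp Require Import all_boot all_order all_algebra zify lra.

(* Cut an [n * n] matrix avoiding [J_k] into blocks of side [4^k]. Contracting
   the blocks yields a matrix avoiding [J_k] with about [n / 4^k] rows, so there
   are few nonzero blocks, and those with fewer than [2^(k-1)] nonzero rows and
   columns contain at most [4^(k-1)] ones each. In a column of blocks, at most
   [(k-1) 4^(3k-1-a)] blocks have at least [2^a] nonzero columns, by a halving
   induction on the column range. Summing over [k-1 <= a < 2k], and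
   symmetrically for rows, gives
     [ones n <= 4^(k-1) ones N + 2 N (k+1) (k-1) 4^(3k)],  [N ~ n / 4^k],
   and strong induction on [n] concludes, the case [n <= (8/3) (k+1)^2 16^k]
   being trivial. *)

Set Implicit Arguments.
Unset Strict Implicit.
Unset Printing Implicit Defensive.

(** * Interval minors of relations on the natural numbers *)

Lemma has_iotaP (p : pred nat) (h w : nat) :
  reflect (exists2 y : nat, h <= y < h + w & p y) (has p (iota h w)).
Proof.
by apply: (iffP hasP) => -[y yI py]; exists y; rewrite // mem_iota in yI *.
Qed.

(* The fibers of [phi] and [psi] are the intervals; the fibers over values past
   the last index can be merged into the last interval. *)
Definition ones_minor (k l : nat) (A : rel nat) : Prop :=
  exists phi psi : nat -> nat,
    [/\ {homo phi : x y / x <= y}, {homo psi : x y / x <= y}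
      & forall i j, i < k -> j < l ->
          exists x y, [/\ A x y, phi x = i & psi y = j]].

Lemma ones_minor_sub k l (A B : rel nat) :
  subrel A B -> ones_minor k l A -> ones_minor k l B.
Proof.
move=> sAB [phi [psi [hphi hpsi hA]]]; exists phi, psi; split=> // i j ik jl.
by have [x [y [Axy <- <-]]] := hA i j ik jl; exists x, y; split=> //;
  apply: sAB.
Qed.

Lemma ones_minor_tr k l (A : rel nat) :
  ones_minor k l (fun x y => A y x) -> ones_minor l k A.
Proof.
move=> [phi [psi [hphi hpsi hA]]]; exists psi, phi; split=> // i j ik jl.
by have [x [y [Axy <- <-]]] := hA j i jl ik; exists y, x.
Qed.

(** Fibers of [phi \o u] and [psi \o v] are unions of fibers of [u] and [v], so the ones of [B] lift
    to [A]. Taking [v := id] contracts rows only. *)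
Lemma ones_minor_contract k l (A B : rel nat) (u v : nat -> nat) :
    {homo u : x y / x <= y} -> {homo v : x y / x <= y} ->
    (forall i j, B i j -> exists x y, [/\ A x y, u x = i & v y = j]) ->
  ones_minor k l B -> ones_minor k l A.
Proof.
move=> hu hv hB [phi [psi [hphi hpsi h]]]; exists (phi \o u), (psi \o v).
split=> [x y /hu/hphi|x y /hv/hpsi|i j ik jl] //.
have [i' [j' [/hB[x [y [Axy <- <-]]] <- <-]]] := h i j ik jl.
by exists x, y.
Qed.

(** * Rows with many ones in a window of columns *)

(** Rows and columns keep their positions, so the maps of a minor need no reindexing when rows or
    columns are added. *)
Definition restrict (S : seq nat) (h w : nat) (A : rel nat) : rel nat :=
  fun x y => [&& x \in S, h <= y < h + w & A x y].

(** Mapping a row to its rank in [S] separates the rows of [S], and each of them has a one in the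
    single column interval. *)
Lemma ones_minor1 k S h w (A : rel nat) :
    sorted ltn S -> k <= size S ->
    (forall x, x \in S -> has (A x) (iota h w)) ->
  ones_minor k 1 (restrict S h w A).
Proof.
move=> sS kS hS; exists (fun x => count (ltn^~ x) S), (fun=> 0); split=> //.
  move=> x y xy; apply: sub_count => z /= /leq_trans; exact.
move=> i j ik; rewrite ltnS leqn0 => /eqP->.
have iS : i < size S by apply: leq_trans kS.
have xS := mem_nth 0 iS.
have /has_iotaP[y yI Axy] := hS _ xS.
exists (nth 0 S i), y; split=> //; first by rewrite /restrict xS yI.
have /(sorted_ltn_nth ltn_trans 0) mono := sS.
have -> : count (ltn^~ (nth 0 S i)) S = count (ltn^~ (nth 0 S i)) (take i S)
    + count (ltn^~ (nth 0 S i)) (drop i S) by rewrite -count_cat cat_take_drop.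
have -> : count (ltn^~ (nth 0 S i)) (take i S) = i.
  transitivity (size (take i S)); last exact: size_takel (ltnW iS).
  apply/eqP; rewrite -all_count; apply/(all_nthP 0) => z.
  rewrite size_takel ?(ltnW iS) // => zi; rewrite nth_take //=.
  by apply: mono (zi) => //; rewrite inE (ltn_trans zi).
suff -> : count (ltn^~ (nth 0 S i)) (drop i S) = 0 by rewrite addn0.
apply/eqP; rewrite -leqn0 leqNgt -has_count; apply/hasPn => z /(nthP 0)[m].
rewrite size_drop nth_drop => mS <- /=; rewrite -leqNgt.
have [->|m0] := posnP m; first by rewrite addn0.
apply/ltnW/mono; first by [].
  by rewrite inE -ltn_subRL.
by rewrite -[ltnLHS]addn0 ltn_add2l.
Qed.

Lemma ones_minor_right k l S h w1 w2 (A : rel nat) :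
    (forall x, x \in S -> has (A x) (iota (h + w1) w2)) ->
    ones_minor k l.+1 (restrict S h w1 A) ->
  ones_minor k l.+2 (restrict S h (w1 + w2) A).
Proof.
move=> hS [phi [psi [hphi hpsi hA]]].
(* [psi] may exceed [l] on the left window; the cap reserves the value [l.+1] for the right
   window. *)
exists phi, (fun y => if y < h + w1 then minn (psi y) l else l.+1); split=> //.
  move=> x y xy; have := hpsi _ _ xy.
  by case: (ltnP x); case: (ltnP y); lia.
move=> i j ik; rewrite ltnS leq_eqVlt => /predU1P[->|jl].
  (* The new column reuses the row realizing entry [(i, 0)]: it lies in [S], so it has a one in the
     right window. *)
  have [x [_ [/and3P[xS _ _] phix _]]] := hA i 0 ik isT.
  have /has_iotaP[y yI Axy] := hS _ xS.
  by exists x, y; split; rewrite // ?/restrict ?xS ?Axy ?andbT;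
    [lia|case: (ltnP y); lia].
have [x [y [/and3P[xS yI Axy] phix psiy]]] := hA i j ik jl.
exists x, y; split; rewrite // ?/restrict ?xS ?Axy ?andbT; first lia.
by case: (ltnP y); lia.
Qed.

Lemma ones_minor_left k l S h w1 w2 (A : rel nat) :
    (forall x, x \in S -> has (A x) (iota h w1)) ->
    ones_minor k l.+1 (restrict S (h + w1) w2 A) ->
  ones_minor k l.+2 (restrict S h (w1 + w2) A).
Proof.
move=> hS [phi [psi [hphi hpsi hA]]].
exists phi, (fun y => if y < h + w1 then 0 else (psi y).+1); split=> //.
  move=> x y xy; have := hpsi _ _ xy.
  by case: (ltnP x); case: (ltnP y); lia.
move=> i [|j] ik jl.
  have [x [_ [/and3P[xS _ _] phix _]]] := hA i 0 ik isT.
  have /has_iotaP[y yI Axy] := hS _ xS.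
  by exists x, y; split; rewrite // ?/restrict ?xS ?Axy ?andbT;
    [lia|case: (ltnP y); lia].
have [x [y [/and3P[xS yI Axy] phix psiy]]] := hA i j ik jl.
exists x, y; split; rewrite // ?/restrict ?xS ?Axy ?andbT; first lia.
by case: (ltnP y); lia.
Qed.

Lemma restrict_sub S S' h h' w w' (A : rel nat) :
    {subset S <= S'} -> h' <= h -> h + w <= h' + w' ->
  subrel (restrict S h w A) (restrict S' h' w' A).
Proof.
move=> sS hh ww x y /and3P[/sS xS yI Axy].
by rewrite /restrict xS Axy andbT /=; lia.
Qed.

(* Halve the column range: a row that is empty on one side is handled on the
   other side; the remaining rows with many ones on one side avoid one column
   fewer there, since the other half serves as the missing column. *)
Lemma wide_rows_bound k l a m h S (A : rel nat) :
    sorted ltn S -> l <= a -> a <= m ->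
    (forall x, x \in S -> 2 ^ a <= count (A x) (iota h (2 ^ m))) ->
    ~ ones_minor k.+1 l.+1 (restrict S h (2 ^ m) A) ->
  size S <= k * 4 ^ (l + m - a).
Proof.
elim: m l a h S => [|m IH] [|l] a h S sS la am hS noJ.
(* If [l = 0], then [k.+1] nonempty rows would already form the minor. The case of positive [l] with
   [m = 0] contradicts [l <= a <= m]. *)
1,3: suff /leq_trans->: size S <= k by rewrite // leq_pmulr // expn_gt0.
1,2: rewrite leqNgt; apply: contra_notN noJ => kS.
1,2: apply: ones_minor1 => // x xS.
1,2: by rewrite has_count; apply: leq_trans (hS x xS); rewrite expn_gt0.
  by lia.
case: a la am hS => // a la am hS.
have eqw : 2 ^ m.+1 = 2 ^ m + 2 ^ m by rewrite expnS mul2n addnn.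
pose L x := count (A x) (iota h (2 ^ m)).
pose R x := count (A x) (iota (h + 2 ^ m) (2 ^ m)).
have LR x : x \in S -> 2 ^ a + 2 ^ a <= L x + R x.
  by move=> /hS; rewrite eqw iotaD count_cat /L /R expnS mul2n addnn.
have leL x : L x <= 2 ^ m by rewrite -[leqRHS](size_iota h) count_size.
have leR x : R x <= 2 ^ m.
  by rewrite -[leqRHS](size_iota (h + 2 ^ m)) count_size.
have a0 : 0 < 2 ^ a by rewrite expn_gt0.
pose S1 := [seq x <- S | (0 < R x) && (2 ^ a <= L x)].
pose S2 := [seq x <- S | (0 < L x) && (2 ^ a <= R x)].
pose S3 := [seq x <- S | R x == 0].
pose S4 := [seq x <- S | L x == 0].
(* A row with an empty half is in [S3] or [S4]; otherwise a half with at least [2 ^ a] ones puts it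
   in [S1] or [S2]. *)
have leS : size S <= size S1 + size S2 + (size S3 + size S4).
  have : all (fun x => 2 ^ a + 2 ^ a <= L x + R x) S by apply/allP.
  rewrite /S1 /S2 /S3 /S4 !size_filter; elim: (S) => //= x s IHs /andP[hx hs].
  by have := IHs hs; lia.
have sub (p : pred nat) : {subset filter p S <= S}.
  by move=> x; rewrite mem_filter => /andP[].
have sortf (p : pred nat) : sorted ltn (filter p S).
  by apply: sorted_filter => //; apply: ltn_trans.
have bound1 : size S1 <= k * 4 ^ (l + m - a).
  apply: (IH l a h) => // [|x|/ones_minor_right noJ1]; first exact: sortf.
    by rewrite mem_filter => /andP[/andP[]].
  apply: noJ; apply: ones_minor_sub (noJ1 (2 ^ m) _); last first.
    by move=> x; rewrite mem_filter has_count => /andP[/andP[]].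
  apply: (restrict_sub (@sub _)) => //; rewrite ?eqw ?addnA; lia.
have bound2 : size S2 <= k * 4 ^ (l + m - a).
  apply: (IH l a (h + 2 ^ m)) => // [|x|/ones_minor_left noJ1].
    exact: sortf.
    by rewrite mem_filter => /andP[/andP[]].
  apply: noJ; apply: ones_minor_sub (noJ1 _); last first.
    by move=> x; rewrite mem_filter has_count => /andP[/andP[]].
  apply: (restrict_sub (@sub _)) => //; rewrite ?eqw ?addnA; lia.
(* Here [a = m], so the rows of [S] are full and [S3], [S4] are empty; the induction hypothesis for
   these two would require [a.+1 <= m]. *)
have [ma|ma] := leqP m a.
  have big x : x \in S -> 0 < L x /\ 0 < R x.
    move=> /LR; have := leL x; have := leR x.
    have -> : m = a by lia.
    lia.
  have S30 : size S3 = 0.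
    apply/eqP; rewrite size_filter -leqn0 leqNgt -has_count.
    by apply/hasPn => x /big[]; lia.
  have S40 : size S4 = 0.
    apply/eqP; rewrite size_filter -leqn0 leqNgt -has_count.
    by apply/hasPn => x /big[]; lia.
  have -> : l.+1 + m.+1 - a.+1 = (l + m - a).+1 by lia.
  by rewrite expnS; nia.
have bound3 : size S3 <= k * 4 ^ (l.+1 + m - a.+1).
  apply: (IH l.+1 a.+1 h) => // [|x|noJ1]; first exact: sortf.
    rewrite mem_filter => /andP[/eqP R0 /LR]; rewrite R0 expnS mul2n -addnn.
    by rewrite addn0.
  by apply/noJ/(ones_minor_sub _ noJ1)/(restrict_sub (@sub _));
    rewrite ?eqw; lia.
have bound4 : size S4 <= k * 4 ^ (l.+1 + m - a.+1).
  apply: (IH l.+1 a.+1 (h + 2 ^ m)) => // [|x|noJ1]; first exact: sortf.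
    by rewrite mem_filter => /andP[/eqP L0 /LR]; rewrite L0 expnS mul2n -addnn.
  by apply/noJ/(ones_minor_sub _ noJ1)/(restrict_sub (@sub _));
    rewrite ?eqw; lia.
(* All four parts have the same bound [k * 4 ^ (l + m - a)]; the exponent of the goal is larger by
   one, which pays for their number. *)
have e1 : l.+1 + m - a.+1 = l + m - a by lia.
have -> : l.+1 + m.+1 - a.+1 = (l + m - a).+1 by lia.
by move: bound3 bound4; rewrite e1 expnS; nia.
Qed.

(** * Cutting into blocks and counting ones per block *)

Lemma leq_sum_const (F : nat -> nat) n c :
  (forall i, F i <= c) -> \sum_(0 <= i < n) F i <= n * c.
Proof.
by move=> Fc; rewrite -[n in n * c]subn0 -sum_nat_const_nat leq_sum.
Qed.

Definition ones (n : nat) (A : rel nat) : nat :=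
  \sum_(0 <= x < n) \sum_(0 <= y < n) A x y.

Definition block (s i : nat) : seq nat := iota (i * s) s.

Definition contract_rel (s : nat) (A : rel nat) : rel nat :=
  fun i j => has (fun x => has (A x) (block s j)) (block s i).

(** On the transposed relation with block indices exchanged, this counts nonzero rows, so one
    estimate serves both directions. *)
Definition block_width (s : nat) (A : rel nat) (i j : nat) : nat :=
  count (fun y => has (A^~ y) (block s i)) (block s j).

Lemma mem_block s i x : 0 < s -> (x \in block s i) = (x %/ s == i).
Proof.
move=> s0; rewrite mem_iota eqn_leq leq_divRL // andbC.
rewrite -[x %/ s <= i]ltnS ltn_divLR //.
by rewrite mulSn addnC.
Qed.

Lemma block_width_le s A i j : block_width s A i j <= s.
Proof. by rewrite -[leqRHS](size_iota (j * s)) count_size. Qed.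

Lemma block_width_gt0 s A i j : 0 < block_width s A i j -> contract_rel s A i j.
Proof.
rewrite -has_count => /hasP[y yj /hasP[x xi Axy]].
by apply/hasP; exists x => //; apply/hasP; exists y.
Qed.

(** Every one lies in a nonzero row and a nonzero column of the rectangle. *)
Lemma sum_rect_le X Y (A : rel nat) :
  \sum_(x <- X) \sum_(y <- Y) A x y
    <= count (fun y => has (A^~ y) X) Y * count (fun x => has (A x) Y) X.
Proof.
rewrite mulnC -!sum1_count !(big_mkcond (fun x => has _ _)) big_distrlr /=.
rewrite !(big_seq _ _ X); apply: leq_sum => x xX.
rewrite !(big_seq _ _ Y); apply: leq_sum => y yY.
case Axy: (A x y) => //.
have -> : has (A x) Y by apply/hasP; exists y.
by have -> : has (A^~ y) X by apply/hasP; exists x.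
Qed.

Lemma ones_blocks n N s (A : rel nat) : n <= N * s ->
  ones n A <= \sum_(0 <= i < N) \sum_(0 <= j < N)
                block_width s A i j * block_width s (fun x y => A y x) j i.
Proof.
move=> nNs.
have blockE i : index_iota (i * s) (i.+1 * s) = block s i.
  by rewrite /index_iota -mulnBl subSnn mul1n.
(* The square of side [N * s] is a union of whole blocks and contains the original one. *)
apply: (@leq_trans (ones (N * s) A)).
  rewrite /ones (big_cat_nat (leq0n n) nNs) //= -[leqLHS]addn0 leq_add //.
  by apply: leq_sum => x _; rewrite (big_cat_nat (leq0n n) nNs) //= leq_addr.
rewrite /ones big_nat_mul; apply: leq_sum => i _.
under eq_bigr do rewrite big_nat_mul.
rewrite exchange_big /=; apply: leq_sum => j _.
by rewrite !blockE; apply: sum_rect_le.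
Qed.

Lemma ones_minor_block k l s (A : rel nat) : 0 < s ->
  ones_minor k l (contract_rel s A) -> ones_minor k l A.
Proof.
move=> s0; apply: (@ones_minor_contract _ _ _ _ (divn^~ s) (divn^~ s)).
- by move=> x y; apply: leq_div2r.
- by move=> x y; apply: leq_div2r.
move=> i j /hasP[x]; rewrite mem_block // => /eqP xi /hasP[y].
by rewrite mem_block // => /eqP yj Axy; exists x, y.
Qed.

(** Collapse each row of blocks to a single row but keep the columns: a wide block in block column
    [j] becomes a row with many ones in a window of length [2 ^ (k.+1 + k.+1)], so [wide_rows_bound]
    applies with [a = k + c]. *)
Lemma wide_blocks_bound k c j N (A : rel nat) : c <= k.+1 ->
    ~ ones_minor k.+1 k.+1 A ->
  \sum_(0 <= i < N) (2 ^ (k + c) <= block_width (4 ^ k.+1) A i j)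
    <= k * 4 ^ (k.+1 + k.+1 - c).
Proof.
move=> ck noJ; set s := 4 ^ k.+1.
have s0 : 0 < s by rewrite expn_gt0.
have sE : s = 2 ^ (k.+1 + k.+1) by rewrite /s -(expnM 2 2) addnn -mul2n.
pose C : rel nat := fun i y => has (A^~ y) (block s i).
pose S := [seq i <- iota 0 N | 2 ^ (k + c) <= block_width s A i j].
have <- : size S = \sum_(0 <= i < N) (2 ^ (k + c) <= block_width s A i j).
  rewrite size_filter -sum1_count big_mkcond /index_iota subn0 /=.
  by apply: eq_bigr => i _; case: leqP.
have -> : k.+1 + k.+1 - c = k + (k.+1 + k.+1) - (k + c) by lia.
apply: (@wide_rows_bound k k (k + c) (k.+1 + k.+1) (j * s) S C).
- by apply: sorted_filter; [apply: ltn_trans|apply: iota_ltn_sorted].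
- by apply: leq_addr.
- by lia.
- by move=> i; rewrite mem_filter -sE => /andP[].
move=> hJ; apply: noJ; move: hJ.
apply: (@ones_minor_contract _ _ _ _ (divn^~ s) id) => //.
  by move=> x y; apply: leq_div2r.
move=> i y /and3P[_ _ /hasP[x]]; rewrite mem_block // => /eqP xi Axy.
by exists x, y.
Qed.

(* A [p * q] block of maximum side [M] with [2^a <= M <= 2^a.+1] has at most
   [4^a.+1] ones; the layer [c] is [a = k + c]. *)
Lemma dyadic_layers k p q : p <= 4 ^ k.+1 -> q <= 4 ^ k.+1 ->
  p * q <= 4 ^ k * (0 < p * q) + \sum_(0 <= c < k.+2)
     4 ^ (k.+1 + c) * ((2 ^ (k + c) <= p) + (2 ^ (k + c) <= q)).
Proof.
have e4 a : 4 ^ a = 2 ^ a * 2 ^ a by rewrite -expnMn.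
wlog pq : p q / p <= q.
  move=> W hp hq; have [pq|/ltnW pq] := leqP p q; first exact: W.
  rewrite mulnC; apply: leq_trans (W q p pq hq hp) _; rewrite leq_add2l.
  by apply: leq_sum => c _; apply: leq_mul => //; rewrite addnC.
move=> _ hq; have [->|pq0] := posnP (p * q) => //.
have q0 : 0 < q by move: pq0; rewrite muln_gt0 => /andP[].
have pqq : p * q <= q * q by rewrite leq_mul2r pq orbT.
have [qk|kq] := ltnP q (2 ^ k).
  by rewrite muln1; apply: leq_trans (leq_addr _ _); rewrite e4; nia.
(* The cap matters only for [q = 4 ^ k.+1], whose logarithm would fall just past the last layer;
   there [q <= 2 ^ a.+1] is an equality. *)
pose a := minn (trunc_log 2 q) (k + k.+1).
have ak : k <= a.
  by rewrite /a leq_min leq_addr andbT; apply: trunc_log_max.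
have aq : 2 ^ a <= q.
  apply: leq_trans (trunc_logP (isT : 1 < 2) q0).
  by rewrite leq_pexp2l // geq_minl.
have qa : q <= 2 ^ a.+1.
  rewrite /a /minn; case: ifP => _.
    by apply/ltnW/trunc_log_ltn.
  by apply: leq_trans hq _; rewrite -(expnM 2 2) -addSn addnn mul2n.
have ac : a - k < k.+2 by rewrite /a; lia.
apply: leq_trans (leq_addl _ _).
rewrite big_mkord (bigD1 (Ordinal ac)) //=.
apply: leq_trans (leq_addr _ _).
rewrite addSn subnKC // aq; apply: leq_trans pqq _.
by rewrite e4; nia.
Qed.

(** * The recursive inequality and the induction on the side *)

Lemma ones_step k n N (A : rel nat) : n <= N * 4 ^ k.+1 ->
    ~ ones_minor k.+1 k.+1 A ->
  ones n A <= 4 ^ k * ones N (contract_rel (4 ^ k.+1) A)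
                + 2 * N * (k.+2 * (k * 4 ^ (3 * k.+1))).
Proof.
move=> nN noJ; apply: leq_trans (ones_blocks _ nN) _.
set s := 4 ^ k.+1; pose A' x y := A y x.
have noJ' : ~ ones_minor k.+1 k.+1 A' by move/ones_minor_tr.
pose w c i j := (2 ^ (k + c) <= block_width s A i j) : nat.
pose w' c i j := (2 ^ (k + c) <= block_width s A' j i) : nat.
apply: (@leq_trans (\sum_(0 <= i < N) \sum_(0 <= j < N)
    (4 ^ k * contract_rel s A i j + \sum_(0 <= c < k.+2)
       4 ^ (k.+1 + c) * (w c i j + w' c i j)))).
  apply: leq_sum => i _; apply: leq_sum => j _.
  have := dyadic_layers (block_width_le s A i j) (block_width_le s A' j i).
  move/leq_trans; apply.
  rewrite leq_add2r leq_mul2l; apply/orP; right.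
  by case: posnP => //; rewrite muln_gt0 => /andP[/block_width_gt0 -> _].
rewrite /ones big_distrr /=; under [in leqRHS]eq_bigr do rewrite big_distrr.
under eq_bigr do rewrite big_split.
rewrite big_split leq_add2l /=.
under eq_bigr do rewrite exchange_big.
rewrite exchange_big /=.
have -> : 2 * N * (k.+2 * (k * 4 ^ (3 * k.+1))) =
    \sum_(0 <= c < k.+2) (2 * N * (k * 4 ^ (3 * k.+1))).
  by rewrite sum_nat_const_nat subn0 mulnCA.
rewrite !big_nat; apply: leq_sum => c /andP[_ ck].
under eq_bigr do rewrite -big_distrr.
rewrite -big_distrr /=.
under eq_bigr do rewrite big_split.
rewrite big_split /=.
have colW : \sum_(0 <= i < N) \sum_(0 <= j < N) w c i j
    <= N * (k * 4 ^ (k.+1 + k.+1 - c)).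
  rewrite exchange_big; apply: leq_sum_const => j.
  exact: wide_blocks_bound.
have rowW : \sum_(0 <= i < N) \sum_(0 <= j < N) w' c i j
    <= N * (k * 4 ^ (k.+1 + k.+1 - c)).
  apply: leq_sum_const => j.
  exact: wide_blocks_bound.
(* The weight of layer [c] and the bound on its number of blocks have exponents with sum [3 * k.+1],
   so all layers cost the same. *)
have -> : 3 * k.+1 = (k.+1 + c) + (k.+1 + k.+1 - c) by lia.
rewrite (expnD _ (k.+1 + c)); move: colW rowW; nia.
Qed.

(** The factor 3 clears the denominator of [8 / 3]; the side of the minor is [k.+1], whence
    [k.+2]. *)
Lemma ones_bound k n (A : rel nat) : ~ ones_minor k.+1 k.+1 A ->
  3 * ones n A <= 8 * k.+2 ^ 2 * 16 ^ k.+1 * n.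
Proof.
have [m] := ubnP n; elim: m => // m IH in n A * => nm noJ.
set D := 8 * _ * _.
have [nD|Dn] := leqP (3 * n) D.
  apply: (@leq_trans (3 * (n * n))).
    rewrite leq_mul2l; apply/leq_sum_const => x.
    by rewrite -[leqRHS]muln1; apply/leq_sum_const => y; apply: leq_b1.
  by rewrite mulnA leq_mul2r nD orbT.
have q0 : 0 < 4 ^ k by rewrite expn_gt0.
have sE : 4 ^ k.+1 = 4 * 4 ^ k by rewrite expnS.
have DE : D = 128 * (k.+2 * k.+2) * (4 ^ k * 4 ^ k).
  by rewrite /D -mulnn (expnS 16) (expnMn 4 4); nia.
have cubeE : 4 ^ (3 * k.+1) = 64 * (4 ^ k * 4 ^ k * 4 ^ k).
  by rewrite mulnS mulSn mulSn mul1n !expnD; nia.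
pose N := (n %/ 4 ^ k.+1).+1.
have nN : n < N * 4 ^ k.+1 by rewrite -ltn_divLR ?expn_gt0.
have Nn : N * 4 ^ k.+1 <= n + 4 ^ k.+1.
  by rewrite /N mulSn addnC leq_add2r leq_trunc_div.
(* This absorbs the rounding up in [N], both for [N < n] and for [h2]. *)
have large : 8 * k.+2 * 4 ^ k <= n.
  by move: Dn; rewrite DE; move: (4 ^ k) q0 => q q0; nia.
have Nltn : N < n.
  by move: Nn large; rewrite sE; move: (4 ^ k) q0 => q q0; nia.
have noJB : ~ ones_minor k.+1 k.+1 (contract_rel (4 ^ k.+1) A).
  by move/ones_minor_block => h; apply/noJ/h; rewrite expn_gt0.
have hB := IH N _ (leq_trans Nltn nm) noJB.
have := ones_step (ltnW nN) noJ.
rewrite -/D DE in hB *.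
move: (ones N _) hB Nn large => b hB; rewrite sE cubeE.
move: (4 ^ k) q0 hB (ones n A) => q q0 hB o Nn large ho.
(* In the factor [4 * k + 2], the induction hypothesis accounts for [k + 2] and the wide blocks for
   [3 * k]. Then [h2] follows from [4 * q * N <= n + 4 * q] and [large]. *)
have h1 : 3 * o <= 128 * k.+2 * (q * q) * (N * q * (4 * k + 2)) by nia.
have h2 : N * q * (4 * k + 2) <= k.+2 * n by nia.
apply: leq_trans h1 _.
have -> : 128 * (k.+2 * k.+2) * (q * q) * n = 128 * k.+2 * (q * q) * (k.+2 * n).
  by nia.
by rewrite leq_mul2l h2 orbT.
Qed.

(** * Transfer from relations to matrices *)

Definition fibers (k n : nat) (phi : nat -> nat) :
    {ffun 'I_k.+1 -> {set 'I_n}} :=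
  [ffun i : 'I_k.+1 => [set x : 'I_n | minn (phi x) k == i]].

Lemma fibers_decomposition k n (phi : nat -> nat) :
    {homo phi : x y / x <= y} ->
    (forall i : 'I_k.+1, exists x : 'I_n, phi x = i) ->
  interval_decomposition (@fibers k n phi).
Proof.
move=> hphi surj; apply/and3P; split.
- apply/and3P; split.
  + apply/eqP/setP => x; rewrite inE; apply/bigcupP.
    have xk : minn (phi x) k < k.+1 by rewrite ltnS geq_minr.
    exists (fibers k n phi (Ordinal xk)); first exact: imset_f.
    by rewrite ffunE inE.
  + apply/trivIsetP => _ _ /imsetP[i _ ->] /imsetP[j _ ->] neq.
    apply/pred0P => x; rewrite /= !ffunE !inE; apply/negP.
    by case/andP=> /eqP xi /eqP xj; move: neq; rewrite (_ : i = j) ?eqxx //;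
      apply/val_inj; rewrite /= -xi -xj.
  + apply/imsetP => -[i _ /setP]; have [x xi] := surj i.
    by move/(_ x); rewrite ffunE !inE xi (minn_idPl (leq_ord i)) eqxx.
- apply/forallP => i; apply/forall_inP => x; rewrite ffunE inE => /eqP xi.
  apply/forall_inP => z; rewrite inE => /eqP zi.
  apply/forallP => y; apply/implyP => /andP[/hphi xy /hphi yz].
  by rewrite inE; lia.
- apply/forallP => i; apply/forallP => j; apply/implyP => ij.
  apply/forall_inP => x; rewrite ffunE inE => /eqP xi.
  apply/forall_inP => y; rewrite ffunE inE => /eqP yj.
  by rewrite ltnNge; apply/negP => /hphi; lia.
Qed.

(** Extending the matrix by zeros allows blocks that overrun it, while every one still has its
    indices in range. *)
Definition mx_rel (n : nat) (A : 'M[bool]_n) : rel nat := fun x y =>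
  [exists i : 'I_n, exists j : 'I_n, [&& i == x :> nat, j == y :> nat & A i j]].

Lemma mx_relP n (A : 'M[bool]_n) x y : mx_rel A x y ->
  exists i j : 'I_n, [/\ x = i, y = j & A i j].
Proof.
case/existsP => i /existsP[j /and3P[/eqP <- /eqP <- Aij]].
by exists i, j.
Qed.

Lemma mx_relE n (A : 'M[bool]_n) (i j : 'I_n) : mx_rel A i j = A i j.
Proof.
apply/idP/idP; last by move=> Aij; apply/existsP; exists i; apply/existsP;
  exists j; rewrite !eqxx.
by case/mx_relP => i' [j' [/val_inj -> /val_inj ->]].
Qed.

Lemma ones_minor_interval_minor k n (A : 'M[bool]_n) :
  ones_minor k.+1 k.+1 (mx_rel A) -> interval_minor (all_ones_mx k.+1) A.
Proof.
move=> [phi [psi [hphi hpsi hA]]].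
apply/existsP; exists (fibers k n phi); apply/existsP; exists (fibers k n psi).
apply/and3P; split.
(* Entry [(i, 0)] of the minor supplies a matrix row in the fiber over [i]. *)
- apply: fibers_decomposition => // i.
  have [_ [_ [/mx_relP[x [_ [-> _ _]]] <- _]]] := hA i 0 (ltn_ord i) isT.
  by exists x.
- apply: fibers_decomposition => // j.
  have [_ [_ [/mx_relP[_ [y [_ -> _]]] _ <-]]] := hA 0 j isT (ltn_ord j).
  by exists y.
apply/forallP => i; apply/forallP => j; rewrite !mxE /=.
have [_ [_ [/mx_relP[x [y [-> -> Axy]]] xi yj]]] :=
  hA _ _ (ltn_ord i) (ltn_ord j).
apply/forall_inPn; exists x.
  by rewrite ffunE inE xi (minn_idPl (leq_ord i)).
apply/forall_inPn; exists y; last by rewrite negbK.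
by rewrite ffunE inE yj (minn_idPl (leq_ord j)).
Qed.

Lemma num_ones_rel n (A : 'M[bool]_n) : num_ones A = ones n (mx_rel A).
Proof.
rewrite /num_ones /ones big_mkord.
under [RHS]eq_bigr do rewrite big_mkord.
rewrite pair_bigA -sum1_card big_mkcond; apply: eq_bigr => -[i j] _ /=.
by rewrite inE /= mx_relE; case: (A i j).
Qed.

Lemma exm_ones_bound k n :
  3 * exm n (all_ones_mx k.+1) <= 8 * k.+2 ^ 2 * 16 ^ k.+1 * n.
Proof.
rewrite mulnC -(leq_divRL _ _ (isT : 0 < 3)); apply/bigmax_leqP => A noJ.
rewrite (leq_divRL _ _ (isT : 0 < 3)) mulnC num_ones_rel; apply: ones_bound.
by apply: contraNnot noJ; apply: ones_minor_interval_minor.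
Qed.

Import Order.TTheory GRing.Theory Num.Theory.
Local Open Scope ring_scope.

Theorem theorem1p6 (k n : nat) (k_gt0 : (0 < k)%N) :
  (exm n (all_ones_mx k))%:R
    <= 8%:R / 3%:R * (k%:R + 1) ^+ 2 * 2%:R ^+ (4 * k) * n%:R :> rat.
Proof.
case: k k_gt0 => [k_gt0|k _]; first by discriminate.
have := exm_ones_bound k n.
rewrite -(ler_nat rat) !natrM !natrX -[k.+2%:R]natr1 exprM.
have -> : 2%:R ^+ 4 = 16%:R :> rat by rewrite -natrX.
lra.
Qed.
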